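(* Let $F$ be a field, let $(p_n)_{n \in \mathbb{N}}$ be a strictly increasing sequence of odd primes such that $\sum_{n=1}^\infty \frac{1}{p_n} < \frac{1}{3}$, and let $\beta > 1$ be an irrational number. Set $$A := \bigg\{ \frac{1}{p_{j_k}} + \sum_{i=1}^\ell \frac{1}{p_{j_i}} \ \Big|\ k, \ell \in \mathbb{N},\ 1 \le k \le \ell,\ j_1 < j_2 < \cdots < j_\ell \text{ in } \mathbb{N} \bigg\}, \qquad B := \{\beta\} \cup \bigg\{ \beta - \sum_{i=1}^\ell \frac{1}{p_i} \ \Big|\ \ell \in \mathbb{N} \bigg\},$$ and let $M$ be the additive submonoid of $\mathbb{R}_{\ge 0}$ generated by $A \cup B$. Then the monoid algebra $F[M]$ is weak-ACCP but does not satisfy ACCP.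
   Context: $\mathbb{N}$ is the set of positive integers. $F[M]$ is the monoid ring of polynomial expressions $\sum_i r_i X^{m_i}$ with coefficients $r_i\in F$ and exponents $m_i\in M$; it is an integral domain. An integral domain $R$ satisfies ACCP if every ascending chain of principal ideals of $R$ eventually stabilizes; an element $x\in R$ satisfies ACCP if every ascending chain of principal ideals of $R$ starting at $Rx$ eventually stabilizes. $R$ is atomic if every nonzero nonunit of $R$ is a finite product of irreducibles. $R$ is weak-ACCP if it is atomic and every nonempty finite subset $S$ of $R\setminus\{0\}$ has a common divisor $d\in R$ such that $\frac{s}{d}$ satisfies ACCP in $R$ for some $s\in S$. *)

(* Defs.v *)
From HB Require Import structures.
From mathcomp Require Import all_boot all_order all_algebra.
From mathcomp Require Import finmap monalg.
From mathcomp Require Import all_classical all_reals all_analysis.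
Set Implicit Arguments.
Unset Strict Implicit.
Unset Printing Implicit Defensive.
Import Order.TTheory GRing.Theory Num.Theory.
Local Open Scope classical_set_scope.
Local Open Scope ring_scope.

Section ChainConditions.
Context {R : idomainType}.
Implicit Types (a d x : R) (S : set R).

Definition principal_ideal a : set R := [set a * r | r in [set: R]].

Definition stabilizes (I : nat -> set R) : Prop :=
  exists N : nat, forall n : nat, (N <= n)%N -> I n = I N.

Definition principal_chain (a : nat -> R) : Prop :=
  forall n : nat, principal_ideal (a n) `<=` principal_ideal (a n.+1).

Definition elt_ACCP x : Prop :=
  forall a : nat -> R, principal_chain a ->
    principal_ideal (a 0%N) = principal_ideal x ->
    stabilizes (fun n => principal_ideal (a n)).

Definition divides d x : Prop := exists q : R, x = d * q.

Definition irreducible_elt x : Prop :=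
  [/\ x != 0, x \isn't a GRing.unit &
      forall y z : R, x = y * z ->
        y \is a GRing.unit \/ z \is a GRing.unit].

End ChainConditions.

Definition ACCP (R : idomainType) : Prop :=
  forall a : nat -> R, principal_chain a ->
    stabilizes (fun n => principal_ideal (a n)).

Definition atomic (R : idomainType) : Prop :=
  forall x : R, x != 0 -> x \isn't a GRing.unit ->
    exists2 s : seq R, (forall y, y \in s -> irreducible_elt y)
                     & x = \prod_(y <- s) y.

(* The quotient s / d is the t with s = d * t: it is unique since s, hence d,
   is nonzero, whereas the library's s / d is junk when d is not a unit. *)
Definition weak_ACCP (R : idomainType) : Prop :=
  atomic R /\
  forall S : set R, finite_set S -> S !=set0 -> S `<=` [set x | x != 0] ->
    exists2 d : R, (forall s, S s -> divides d s)
                 & exists2 s, S s & exists2 t, s = d * t & elt_ACCP t.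

Record nneg_submonoid (R : realType) := NnegSubmonoid {
  nneg_set :> set R;
  nneg_set0 : nneg_set 0;
  nneg_setD : forall x y, nneg_set x -> nneg_set y -> nneg_set (x + y);
  nneg_set_ge0 : nneg_set `<=` [set x | 0 <= x] }.

Definition add_submonoid (R : realType) (N : set R) : Prop :=
  N 0 /\ forall x y, N x -> N y -> N (x + y).

Section Generated.
Context {R : realType} (G : set R).

Let N := smallest (@add_submonoid R) G.

Let N0 : N 0. Proof. by move=> A [[A0 _] _]. Qed.

Let ND x y : N x -> N y -> N (x + y).
Proof. by move=> Nx Ny A AG; apply: AG.1.2; [exact: Nx|exact: Ny]. Qed.

Let N_ge0 : G `<=` [set x | 0 <= x] -> N `<=` [set x | 0 <= x].
Proof.
move=> G0; apply: smallest_sub => //; split=> /= [|x y]; first exact: lexx.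
exact: addr_ge0.
Qed.

Definition generated_submonoid (G_ge0 : G `<=` [set x | 0 <= x]) :
  nneg_submonoid R := NnegSubmonoid N0 ND (N_ge0 G_ge0).

End Generated.

Section Exponents.
Context {R : realType} (M : nneg_submonoid R).

(* [monalg] requires a multiplicatively written monoid of monomials in which
   only 1 is invertible: the exponent m stands for the monomial X^m. *)
Definition exponent : Type := set_type M.

HB.instance Definition _ := Choice.on exponent.

Definition exponent_val (m : exponent) : R := sval m.

Lemma exponent_val_inj : injective exponent_val.
Proof. exact: val_inj. Qed.

Lemma exponentP (m : exponent) : (M : set R) (exponent_val m).
Proof. by case: m => x /= /set_mem. Qed.

Definition Exponent (x : R) (Mx : (M : set R) x) : exponent :=
  exist _ x (mem_set Mx).

Definition exponent0 : exponent := Exponent (nneg_set0 M).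

Definition exponentD (m1 m2 : exponent) : exponent :=
  Exponent (nneg_setD (exponentP m1) (exponentP m2)).

Fact exponentDA : associative exponentD.
Proof. by move=> x y z; apply: exponent_val_inj; rewrite /= addrA. Qed.

Fact exponentDC : commutative exponentD.
Proof. by move=> x y; apply: exponent_val_inj; rewrite /= addrC. Qed.

Fact exponent0D : left_id exponent0 exponentD.
Proof. by move=> x; apply: exponent_val_inj; rewrite /= add0r. Qed.

Fact exponentD0 : right_id exponent0 exponentD.
Proof. by move=> x; apply: exponent_val_inj; rewrite /= addr0. Qed.

Fact exponentD_eq0 x y :
  exponentD x y = exponent0 -> x = exponent0 /\ y = exponent0.
Proof.
move=> /(congr1 exponent_val) /= /eqP.
have := nneg_set_ge0 (exponentP x); have := nneg_set_ge0 (exponentP y).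
move=> /= y0 x0; rewrite paddr_eq0// => /andP[/eqP ex /eqP ey].
by split; apply: exponent_val_inj.
Qed.

HB.instance Definition _ := Choice_isMonomialDef.Build exponent
  exponentDA exponent0D exponentD0 exponentD_eq0.
HB.instance Definition _ := MonomialDef_isConomialDef.Build exponent exponentDC.

Lemma exponent_valM (m1 m2 : exponent) :
  exponent_val (mmul m1 m2) = exponent_val m1 + exponent_val m2.
Proof. by []. Qed.

End Exponents.

Section MonoidAlgebra.
Context (F : fieldType) {R : realType} (M : nneg_submonoid R).

Definition monoid_algebra : Type := {malg F[exponent M]}.

HB.instance Definition _ := GRing.ComAlgebra.on monoid_algebra.

Implicit Types g h : monoid_algebra.

Let malg_unit : {pred monoid_algebra} := fun g => `[< exists h, h * g = 1 >].

Let malg_inv g : monoid_algebra := xget g [set h | h * g = 1].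

Fact malg_mulVx : {in malg_unit, left_inverse 1 malg_inv *%R}.
Proof. by move=> g /asboolP; exact: xgetPex. Qed.

Fact malg_unitPl g h : h * g = 1 -> malg_unit g.
Proof. by move=> hg; apply/asboolP; exists h. Qed.

Fact malg_inv_out : {in [predC malg_unit], malg_inv =1 id}.
Proof.
move=> g; rewrite inE /= => /asboolP ng; rewrite /malg_inv xgetPN// => h hg.
by apply: ng; exists h.
Qed.

HB.instance Definition _ := GRing.ComNzRing_hasMulInverse.Build monoid_algebra
  malg_mulVx malg_unitPl malg_inv_out.

Fact malg_top g : g != 0 -> exists2 m, m \in msupp g &
  forall m', m' \in msupp g -> exponent_val m' <= exponent_val m.
Proof.
rewrite -(@msupp_eq0 (exponent M) F g) => /fset0Pn[m0 m0g].
case: (@arg_maxP _ _ (msupp g) [` m0g]%fset predT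
  (fun m => exponent_val (fsval m))) => // m _ mM.
by exists (fsval m); [exact: fsvalP|move=> m' m'g; exact: (mM [` m'g]%fset)].
Qed.

Fact malg_integral g h : g * h = 0 -> (g == 0) || (h == 0).
Proof.
apply: contra_eqT; rewrite negb_or => /andP[g0 h0].
have [m1 m1g m1M] := malg_top g0; have [m2 m2h m2M] := malg_top h0.
apply/eqP => /(congr1 (fun f : {malg F[exponent M]} => f@_(mmul m1 m2))).
rewrite mcoeff0 (mcoeffMl (g : {malg F[exponent M]})).
have split_top k1 k2 : k1 \in msupp g -> k2 \in msupp h ->
    mmul k1 k2 = mmul m1 m2 -> k1 = m1 /\ k2 = m2.
  move=> /m1M k1M /m2M k2M /(congr1 (@exponent_val R M)); rewrite !exponent_valM => e.
  have e1 : exponent_val k1 = exponent_val m1.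
    by apply/eqP; rewrite eq_le k1M/= -(lerD2r (exponent_val m2)) -e lerD2l.
  split; apply: exponent_val_inj => //.
  by move: e; rewrite e1 => /addrI.
rewrite (big_fsetD1 m1)//= (big_fsetD1 m2)//= eqxx.
rewrite [X in _ + X + _]big1_seq => [|k2 /andP[_]]; last first.
  rewrite !inE => /andP[k2m k2h]; case: eqP => // e.
  by have [_ ek] := split_top _ _ m1g k2h e; rewrite ek eqxx in k2m.
rewrite [X in _ + X]big1_seq => [|k1 /andP[_]]; last first.
  rewrite !inE => /andP[k1m k1g]; apply: big1_seq => k2 /andP[_ k2h].
  case: eqP => // e.
  by have [ek _] := split_top _ _ k1g k2h e; rewrite ek eqxx in k1m.
rewrite !addr0 mulr1n => /eqP; rewrite mulf_eq0.
rewrite -!mcoeff_neq0 in m1g m2h.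
by rewrite (negbTE m1g) (negbTE m2h).
Qed.

HB.instance Definition _ :=
  GRing.ComUnitRing_isIntegral.Build monoid_algebra malg_integral.

End MonoidAlgebra.

Section Generators.
Context {R : realType} (p : nat -> nat) (beta : R).

Definition genA : set R :=
  [set x | exists (l : nat) (j : 'I_l -> nat) (k : 'I_l),
     {homo j : i i' / (i < i')%N} /\
     x = (p (j k))%:R^-1 + \sum_(i < l) (p (j i))%:R^-1].

(* The primes are indexed from 0, so [l.+1] runs over the lengths l >= 1. *)
Definition genB : set R :=
  [set beta] `|`
  [set beta - \sum_(i < l.+1) (p i)%:R^-1 | l in [set: nat]].

Lemma gen_ge0 :
  ((\sum_(0 <= n <oo) ((p n)%:R^-1)%:E) < (3%:R^-1 : R)%:E)%E ->
  1 < beta -> genA `|` genB `<=` [set x | 0 <= x].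
Proof.
move=> sum_lt beta_gt1 x [[l [j [k [_ ->]]]]|[->|[l _ <-]]] /=.
- by rewrite addr_ge0 ?sumr_ge0// => *; rewrite invr_ge0.
- exact: ltW (lt_trans ltr01 beta_gt1).
rewrite subr_ge0 (le_trans _ (ltW beta_gt1))// -lee_fin.
have p_ge0 n : (0 <= ((p n)%:R^-1 : R)%:E)%E by rewrite lee_fin invr_ge0.
rewrite -sumEFin -(big_mkord xpredT (fun i => ((p i)%:R^-1 : R)%:E)).
apply: le_trans (nneseries_lim_ge l.+1 (fun n _ _ => p_ge0 n)) _.
by apply: le_trans (ltW sum_lt) _; rewrite lee_fin invf_le1// ler1n.
Qed.

End Generators.

(* Main.v *)
Require Import Defs.
From mathcomp Require Import all_boot all_order all_algebra.
From mathcomp Require Import finmap monalg zify ring lra.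
From mathcomp Require Import all_classical all_reals all_analysis.
Set Implicit Arguments.
Unset Strict Implicit.
Unset Printing Implicit Defensive.
Import Order.TTheory GRing.Theory Num.Theory.
Local Open Scope classical_set_scope.
Local Open Scope ring_scope.

(** Write [b_l] for [beta] minus the sum of the first [l] reciprocals of primes.
    Since [beta] is irrational, every exponent in [M] has a well defined number
    of [beta]s, and this number is additive.

    The exponents [2 b_l] give an infinite strictly ascending chain, because
    [2 b_l = 2 b_(l+1) + 2/p_l] and [2/p_l] lies in [A], so ACCP fails.  With at
    most one [beta] no such chain exists ([exponent_chain_stable]).  The reason
    is arithmetic: an equality between sums of reciprocals of primes [p_j] forces
    the multiplicities of each [1/p_j] to agree modulo [p_j]
    ([wsum_count_mod]).  All the summands split off along a chain from [b_l + a]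
    add up, together with a remainder, to [a] plus a difference of two initial
    segments of the reciprocals; so for all large [j] the multiplicity of [1/p_j]
    is 0 or 1 unless it is at least [p_j], and the latter costs at least 1 in
    value, hence happens boundedly often.  But every element of [A] uses one
    reciprocal twice, so only finitely many elements of [A] can be split off
    ([partial_words_stable]).

    With [c >= 2] copies of [beta] the obstruction disappears: an exponent with
    at least [c] betas is divisible by [c b_L] for every large [L]
    ([mul_genB_nth_divides]), because two or more segments of reciprocals that
    end at the same place overlap, and so regroup into elements of [A].

    In the algebra, order exponents first by decreasing number of betas and then
    by size.  Leading exponents for this order are additive ([leadM]), and an
    element whose leading exponent has at most one [beta] satisfies ACCP: along a
    chain the cofactors eventually have leading exponent 0, and after that a
    nonunit cofactor would lower the number of betas of the ordinary degree
    ([elt_ACCP_low_le1]).  For a finite set of nonzero elements let [c] be the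
    least number of betas of all their exponents.  If [c <= 1] the common divisor
    1 works; otherwise the monomial of exponent [c b_L] divides them all and
    leaves a quotient that contains an exponent free of [beta].  As the monomial
    of exponent [b_L] is irreducible, this decomposition also gives
    atomicity. *)

(** * Natural numbers: stabilization and congruences *)

Lemma nonincreasing_stable (u : nat -> nat) :
  (forall n, u n.+1 <= u n)%N -> exists N, forall n, (N <= n)%N -> u n = u N.
Proof.
move=> u_dec; have u_mono m n : (m <= n)%N -> (u n <= u m)%N.
  move=> /subnKC <-; elim: (n - m)%N => [|k IH]; first by rewrite addn0.
  by rewrite addnS (leq_trans (u_dec _)).
have ex_val : exists k, `[< exists n, u n = k >].
  by exists (u 0%N); apply/asboolP; exists 0%N.
case: (ex_minnP ex_val) => k /asboolP[N <-] min_uN; exists N => n Nn.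
apply/eqP; rewrite eqn_leq u_mono//=.
by apply: min_uN; apply/asboolP; exists n.
Qed.

Lemma bounded_nondecreasing_stable (u : nat -> nat) (b : nat) :
  (forall n, u n <= u n.+1)%N -> (forall n, u n <= b)%N ->
  exists N, forall n, (N <= n)%N -> u n = u N.
Proof.
move=> u_inc u_b.
have [N stableN] : exists N, forall n, (N <= n)%N -> (b - u n = b - u N)%N.
  by apply: nonincreasing_stable => n; apply: leq_sub2l.
exists N => n /stableN e.
by rewrite -(subKn (u_b n)) e subKn.
Qed.

Lemma modn_mul_cancel d q m n : coprime d q ->
  (m * d = n * d %[mod q])%N -> (m = n %[mod q])%N.
Proof.
rewrite coprime_sym => cop; wlog mn : m n / (m <= n)%N => [wl|].
  by case/orP: (leq_total m n) => mn; last move=> /esym; move=> /wl -> .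
move=> /esym/eqP; rewrite eqn_mod_dvd ?leq_mul2r ?mn ?orbT// -mulnBl.
by rewrite Gauss_dvdl// -eqn_mod_dvd// => /eqP ->.
Qed.

(** * Sums of reciprocals of primes *)

(** A word over the indices encodes a formal sum of reciprocals of primes; the
    letters keep the multiplicities that the value of the sum forgets. *)
Definition wsum {R : realType} (p : nat -> nat) (s : seq nat) : R :=
  \sum_(i <- s) (p i)%:R^-1.

Section Words.
Context {R : realType} (p : nat -> nat) (p_incr : {homo p : m n / (m < n)%N})
  (p_prime : forall n, prime (p n)).
Local Notation wsum := (@wsum R p).

Let p_inj : injective p.
Proof.
move=> i j pij.
by case: (ltngtP i j) => // /p_incr; rewrite pij ltnn.
Qed.

Lemma invp_gt0 i : 0 < (p i)%:R^-1 :> R.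
Proof. by rewrite invr_gt0 ltr0n prime_gt0. Qed.

Lemma wsum_nil : wsum [::] = 0. Proof. exact: big_nil. Qed.

Lemma wsum_cons i s : wsum (i :: s) = (p i)%:R^-1 + wsum s.
Proof. exact: big_cons. Qed.

Lemma wsum_cat s t : wsum (s ++ t) = wsum s + wsum t.
Proof. exact: big_cat. Qed.

Lemma wsum_ge0 s : 0 <= wsum s.
Proof. by apply: sumr_ge0 => i _; exact: ltW (invp_gt0 i). Qed.

Let clear_denominators j s d : (forall i, i \in s -> i != j -> p i %| d)%N ->
  (p j * d)%:R * wsum s =
  (count_mem j s * d + p j * \sum_(i <- s | i != j) d %/ p i)%:R.
Proof.
have p0 i : (p i)%:R != 0 :> R by rewrite pnatr_eq0 -lt0n prime_gt0.
elim: s => [_|i s IH dvd_s]; first by rewrite wsum_nil big_nil mulr0 muln0.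
rewrite wsum_cons mulrDr IH => [|k ks]; last first.
  by apply: dvd_s; rewrite inE ks orbT.
rewrite big_cons /=; case: eqP => [->|/eqP ij] /=.
  by rewrite mulSn -addnA [RHS]natrD natrM mulrAC mulfV// mul1r.
rewrite add0n mulnDr addnCA [RHS]natrD; congr (_ + _).
have /dvdnP[e de] := dvd_s i (mem_head _ _) ij.
by rewrite de mulnK ?prime_gt0// !natrM mulrA mulfK.
Qed.

(** After multiplication by [p j] and by a common multiple of the other
    denominators that is prime to [p j], every letter other than [j] contributes
    a multiple of [p j]. *)
Lemma wsum_count_mod s t j : wsum s = wsum t ->
  count_mem j s = count_mem j t %[mod p j].
Proof.
move=> st.
pose u := [seq i <- undup (s ++ t) | i != j]; pose d := (\prod_(i <- u) p i)%N.
have dvd_d i : i \in s ++ t -> i != j -> (p i %| d)%N.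
  move=> ist ij; have iu : i \in u by rewrite mem_filter ij mem_undup.
  by rewrite /d (big_rem i iu) /= dvdn_mulr.
have cop : coprime (p j) d.
  rewrite /d big_seq; elim/big_rec: _ => [|i m]; first exact: coprimen1.
  rewrite mem_filter coprimeMr => /andP[ij _] ->; rewrite andbT.
  rewrite prime_coprime// dvdn_prime2//.
  by apply: contra_neqN ij => /eqP /p_inj.
have e r : {subset r <= s ++ t} ->
    (p j * d)%:R * wsum r = (count_mem j r * d +
      p j * \sum_(i <- r | i != j) d %/ p i)%:R.
  by move=> rst; apply: clear_denominators => i /rst ist; exact: dvd_d.
have : (count_mem j s * d = count_mem j t * d %[mod p j])%N.
  move/(congr1 (fun x => (p j * d)%:R * x)): st.
  rewrite !e => [|i it|i it]; try by rewrite mem_cat it ?orbT.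
  move=> /eqP; rewrite eqr_nat => /eqP /(congr1 (modn^~ (p j))).
  by rewrite ![(_ + p j * _)%N]addnC ![(p j * _)%N]mulnC !modnMDl.
by apply: modn_mul_cancel; rewrite coprime_sym.
Qed.

(** A letter [j] that occurs [p j] times is already worth 1. *)
Lemma size_le_wsum (js s : seq nat) : uniq js ->
  (forall j, j \in js -> p j <= count_mem j s)%N -> (size js)%:R <= wsum s.
Proof.
elim: js s => [|j js IH] s /=; first by move=> *; exact: wsum_ge0.
move=> /andP[jjs js_uniq] heavy.
pose s' := [seq i <- s | i != j].
have -> : wsum s = (count_mem j s)%:R / (p j)%:R + wsum s'.
  rewrite /s' /wsum big_filter (bigID (pred1 j)) /=; congr (_ + _).
  rewrite (eq_bigr (fun=> (p j)%:R^-1)) => [|i /eqP -> //].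
  by rewrite big_const_seq iter_addr_0 mulr_natl.
rewrite -natr1 addrC lerD//.
  rewrite ler_pdivlMr ?mul1r ?ler_nat ?ltr0n ?prime_gt0//.
  by apply: heavy; rewrite inE eqxx.
apply: IH => // i ijs; rewrite (leq_trans (heavy i _)) ?inE ?ijs ?orbT//.
rewrite count_filter; apply: sub_count => k /= /eqP ->; rewrite eqxx.
by apply: contraNneq jjs => <-.
Qed.

Lemma count_lt_le_wsum (m : nat) s :
  (count (fun i => i < m)%N s)%:R <= (p m)%:R * wsum s.
Proof.
elim: s => [|i s IH] /=; first by rewrite wsum_nil mulr0.
rewrite wsum_cons mulrDr natrD lerD//.
case: ltnP => im /=; last by rewrite mulr_ge0// ltW// invp_gt0.
rewrite ler_pdivlMr ?ltr0n ?prime_gt0// mul1r ler_nat ltnW//.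
exact: p_incr.
Qed.

Lemma exists_wsum_bound (x : R) : exists b : nat, x < b%:R.
Proof.
exists (Num.bound `|x|); apply: le_lt_trans (ler_norm x) _.
exact: archi_boundP.
Qed.

(** Let [E n] be the concatenation of the first [n] words [e i].
    Modulo [p j], a letter [j] outside [c] and [w] occurs 0 or 1 times in
    [E n ++ t], since it does so in an initial segment.  If it is repeated in
    [E n], it thus occurs at least [p j] times in [E n ++ t], which can happen
    for boundedly many letters only.  So the set of repeated letters of [E n]
    stops growing, and by boundedness of the values so do the multiplicities of
    the letters below any fixed bound. *)
Lemma partial_words_stable (e : nat -> seq nat) (c w : seq nat) :
  (forall l, wsum (iota 0 l) < 1) ->
  (forall n, exists t l,
    wsum (flatten (mkseq e n) ++ t ++ w) = wsum (c ++ iota 0 l)) ->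
  exists N, forall n, (N <= n)%N -> forall j, (count_mem j (e n) <= 1)%N.
Proof.
move=> iota_lt1 eqE; pose E n := flatten (mkseq e n).
have ES n : E n.+1 = E n ++ e n.
  by rewrite /E mkseqS -cats1 flatten_cat /= cats0.
have countS a n : (count a (E n) <= count a (E n.+1))%N.
  by rewrite ES count_cat leq_addr.
have count_mono a m n : (m <= n)%N -> (count a (E m) <= count a (E n))%N.
  move=> /subnKC <-; elim: (n - m)%N => [|k IH]; first by rewrite addn0.
  by rewrite addnS (leq_trans IH).
have [b b_gt] := exists_wsum_bound (wsum c + 1).
have E_le_b n : exists2 t, wsum (E n ++ t) <= b%:R &
    forall j, j \notin c ++ w -> (2 <= count_mem j (E n) ->
      p j <= count_mem j (E n ++ t))%N.
  have [t [l Etw]] := eqE n; exists (t ++ w) => [|j].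
    by rewrite Etw wsum_cat ltW// (le_lt_trans _ b_gt)// lerD2l ltW.
  rewrite mem_cat negb_or => /andP[/count_memPn jc /count_memPn jw] E2.
  rewrite leqNgt; apply/negP; rewrite !count_cat jw addn0 => small.
  have := wsum_count_mod j Etw.
  rewrite !count_cat jc jw addn0 add0n (count_uniq_mem j (iota_uniq 0 l)).
  rewrite [RHS]modn_small; last first.
    by rewrite (leq_ltn_trans (leq_b1 _))// prime_gt1.
  rewrite modn_small; last exact: small.
  move=> ecount.
  by move: E2; rewrite /E; move: ecount; case: (j \in iota 0 l) => /=; lia.
pose heavy n := [seq j <- undup (E n) | 2 <= count_mem j (E n)]%N.
have mem_heavy n j : (j \in heavy n) = (2 <= count_mem j (E n))%N.
  rewrite mem_filter mem_undup andb_idr// -has_pred1 has_count.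
  by move=> /ltnW.
have heavy_uniq n : uniq (heavy n) by rewrite filter_uniq// undup_uniq.
have heavy_mono m n : (m <= n)%N -> {subset heavy m <= heavy n}.
  by move=> mn j; rewrite !mem_heavy => /leq_trans; apply; apply: count_mono.
have heavy_size n : (size (heavy n) <= size (c ++ w) + b)%N.
  rewrite -(count_predC (mem (c ++ w))) leq_add// -size_filter.
    apply: uniq_leq_size; first exact: filter_uniq.
    by move=> j; rewrite mem_filter => /andP[].
  have [t Etb tmod] := E_le_b n.
  rewrite -(ler_nat R); apply: le_trans Etb; apply: size_le_wsum.
    exact: filter_uniq.
  by move=> j; rewrite mem_filter mem_heavy => /andP[jcw]; exact: tmod.
have [N1 N1P] := bounded_nondecreasing_stable
  (fun n => uniq_leq_size (heavy_uniq n) (heavy_mono n n.+1 (leqnSn n)))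
  heavy_size.
pose m := (\max_(j <- heavy N1) j).+1.
have heavy_lt n j : (N1 <= n)%N -> j \in heavy n -> (j < m)%N.
  move=> N1n jn; rewrite ltnS leq_bigmax_seq//.
  have le_size : (size (heavy n) <= size (heavy N1))%N by rewrite N1P.
  by have [_ ->] := uniq_min_size (heavy_uniq N1) (heavy_mono _ _ N1n) le_size.
have light_bound n : (count (fun i => i < m)%N (E n) <= p m * b)%N.
  have [t Etb _] := E_le_b n.
  rewrite -(ler_nat R) natrM; apply: le_trans (count_lt_le_wsum _ _) _.
  rewrite ler_wpM2l// (le_trans _ Etb)// wsum_cat lerDl.
  exact: wsum_ge0.
have [N2 N2P] := bounded_nondecreasing_stable (countS _) light_bound.
exists (maxn N1 N2) => n; rewrite geq_max => /andP[N1n N2n] j.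
have : count (fun i => i < m)%N (e n) = 0%N.
  have := N2P n.+1 (leqW N2n); rewrite ES count_cat N2P// -[RHS]addn0.
  by move=> /addnI.
case: (ltnP j m) => [jm e0|mj _].
  rewrite (@leq_trans 0)// -e0; apply: sub_count => i /= /eqP -> //.
rewrite leqNgt; apply: contraL mj => e2; rewrite -ltnNge.
apply: (heavy_lt n.+1); first exact: leqW.
by rewrite mem_heavy ES count_cat (leq_trans e2)// leq_addl.
Qed.

End Words.

(** * The rational part of the exponent monoid *)

Definition gen_word (s : seq nat) : bool :=
  if s is k :: js then (k \in js) && uniq js else false.

Definition word_monoid {R : realType} (p : nat -> nat) : set R :=
  [set x | exists2 ss, all gen_word ss & x = wsum p (flatten ss)].

Lemma gen_word_double s : gen_word s -> exists j, (2 <= count_mem j s)%N.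
Proof.
case: s => // k js /andP[kjs _]; exists k.
by rewrite /= eqxx ltnS -has_count has_pred1.
Qed.

Section RationalPart.
Context {R : realType} (p : nat -> nat).
Local Notation wsum := (@wsum R p).
Local Notation wm := (@word_monoid R p).

Lemma word_monoid0 : wm 0.
Proof. by exists [::]; rewrite //= wsum_nil. Qed.

Lemma word_monoidD x y : wm x -> wm y -> wm (x + y).
Proof.
move=> [ss ssP ->] [tt ttP ->]; exists (ss ++ tt).
  by rewrite all_cat ssP.
by rewrite flatten_cat wsum_cat.
Qed.

Lemma word_monoid_word s : gen_word s -> wm (wsum s).
Proof. by move=> sP; exists [:: s]; rewrite /= ?sP ?cats0. Qed.

Lemma word_monoid_genA : genA p `<=` wm.
Proof.
move=> x [l [j [k [j_incr ->]]]].
have j_inj : injective j.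
  move=> i i' jii; apply: val_inj => /=.
  by case: (ltngtP i i') => // /j_incr; rewrite jii ltnn.
pose js := [seq j i | i <- enum 'I_l].
have -> : (p (j k))%:R^-1 + \sum_(i < l) (p (j i))%:R^-1 = wsum (j k :: js).
  by rewrite wsum_cons /wsum big_map big_enum.
apply: word_monoid_word => /=; rewrite map_f ?mem_enum//=.
by rewrite map_inj_uniq ?enum_uniq.
Qed.

Lemma genA_word s : gen_word s -> @genA R p (wsum s).
Proof.
case: s => // k js /andP[kjs js_uniq].
pose t := sort leq js.
have kt : (index k t < size t)%N by rewrite index_mem mem_sort.
exists (size t), (fun i => nth 0%N t i), (Ordinal kt); split.
  move=> i i' ii'; apply: (sorted_ltn_nth ltn_trans); rewrite ?inE//.
  by rewrite ltn_sorted_uniq_leq sort_uniq js_uniq sort_sorted.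
rewrite wsum_cons /= nth_index ?mem_sort//; congr (_ + _).
have tjs : perm_eq t js by rewrite perm_sort.
by rewrite /wsum -(perm_big _ tjs) (big_nth 0%N) big_mkord.
Qed.

(** Peel off [2/p_k] for all letters [k] of [ks] but the last one, which doubles
    a letter of what remains of [js]. *)
Lemma word_monoid_doubled js ks : uniq js -> uniq ks -> ks != [::] ->
  {subset ks <= js} -> wm (wsum js + wsum ks).
Proof.
elim: ks js => // k ks IH js js_uniq /= /andP[kks ks_uniq] _ ksjs.
have kjs : k \in js by apply: ksjs; rewrite mem_head.
have [->|ks0] := eqVneq ks [::].
  rewrite wsum_cons wsum_nil addr0 addrC -wsum_cons.
  by apply: word_monoid_word; rewrite /= kjs.
have -> : wsum js + wsum (k :: ks) =
    wsum [:: k; k] + (wsum (rem k js) + wsum ks).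
  have -> : wsum js = wsum (k :: rem k js) by exact/perm_big/perm_to_rem.
  by rewrite !wsum_cons wsum_nil; ring.
apply: word_monoidD; first by apply: word_monoid_word; rewrite /= mem_head.
apply: IH => //; first exact: rem_uniq.
move=> i iks; rewrite mem_rem_uniq// inE ksjs ?inE ?iks ?orbT// andbT.
by apply: contraNneq kks => <-.
Qed.

(** The letters of the segment from [m] to [L] are shared out among the tails,
    which all contain them: each tail gets one letter, which makes it a generator,
    and the last tail gets all the others. *)
Lemma word_monoid_tails ls m L : ls != [::] -> all (fun l => l <= m)%N ls ->
  (m + size ls <= L)%N ->
  wm (\sum_(l <- ls) wsum (iota l (L - l)) + wsum (iota m (L - m))).
Proof.
elim: ls m => // l ls IH m _ /= /andP[lm lsm] mL; rewrite big_cons.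
have [->|ls0] := eqVneq ls [::].
  rewrite big_nil addr0; apply: word_monoid_doubled; rewrite ?iota_uniq//.
    by rewrite -size_eq0 size_iota; lia.
  by move=> i; rewrite !mem_iota; lia.
have -> : wsum (iota m (L - m)) =
    (p m)%:R^-1 + wsum (iota m.+1 (L - m.+1)).
  have -> : (L - m = (L - m.+1).+1)%N by lia.
  exact: wsum_cons.
rewrite addrACA [_ + _^-1]addrC -wsum_cons; apply: word_monoidD.
  apply: word_monoid_word; rewrite /= iota_uniq mem_iota andbT; lia.
apply: IH => //; last by rewrite addSnnS.
by apply: sub_all lsm => i /leqW.
Qed.

(** The shortest tail is the segment whose letters the other tails share. *)
Lemma word_monoid_all_tails ls : (1 < size ls)%N -> exists L0, forall L,
  (L0 <= L)%N -> wm (\sum_(l <- ls) wsum (iota l (L - l))) /\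
                 all (fun l => l <= L)%N ls.
Proof.
move=> ls2; have : perm_eq (sort geq ls) ls by rewrite perm_sort.
have geq_total : total geq by move=> i j; exact: leq_total.
have := sort_sorted geq_total ls; case: (sort geq ls) => [_|m ks].
  by move/perm_size => /= e; rewrite -e in ls2.
move=> mks ksls; have ks_le : all (fun l => l <= m)%N ks.
  apply: (order_path_min _ mks) => i j k /=; lia.
have sz := perm_size ksls; rewrite /= in sz.
exists (m + size ks)%N => L mL; split.
  have -> : \sum_(l <- ls) wsum (iota l (L - l)) =
      \sum_(l <- m :: ks) wsum (iota l (L - l)).
    by apply: perm_big; rewrite perm_sym.
  rewrite big_cons addrC; apply: word_monoid_tails => //.
  by apply: contraTneq ls2 => ks0; rewrite -sz ks0.
rewrite -(perm_all _ ksls) /=; apply/andP; split; first lia.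
by apply: sub_all ks_le => i /=; lia.
Qed.

End RationalPart.

(** * The exponent monoid and its grading *)

Section Exponents.
Context {R : realType} (p : nat -> nat) (beta : R).
Local Notation wsum := (@wsum R p).

Lemma wsum_iota l : wsum (iota 0 l) = \sum_(i < l) (p i)%:R^-1.
Proof.
by rewrite -(big_mkord xpredT (fun i => (p i)%:R^-1)) /index_iota subn0.
Qed.

Definition genB_nth (l : nat) : R := beta - wsum (iota 0 l).

(** A relation, because the decomposition is not unique; that [n] is determined
    by [x] needs the irrationality of [beta]. *)
Definition has_betas (n : nat) (x : R) : Prop :=
  exists ls a, [/\ size ls = n, word_monoid p a &
                   x = \sum_(l <- ls) genB_nth l + a].

Definition exponents : set R := [set x | exists n, has_betas n x].

Lemma genB_nth_mem l : genB p beta (genB_nth l).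
Proof.
case: l => [|l]; rewrite /genB_nth; first by left; rewrite wsum_nil subr0.
by right; exists l => //; rewrite wsum_iota.
Qed.

Lemma genB_sub_range : genB p beta `<=` range genB_nth.
Proof.
move=> x [->|[l _ <-]]; first by exists 0%N; rewrite // /genB_nth wsum_nil subr0.
by exists l.+1; rewrite // /genB_nth wsum_iota.
Qed.

Lemma has_betasD m n x y :
  has_betas m x -> has_betas n y -> has_betas (m + n) (x + y).
Proof.
move=> [ls [a [<- aP ->]]] [ks [b [<- bP ->]]].
exists (ls ++ ks), (a + b); split; first exact: size_cat.
  exact: word_monoidD.
by rewrite big_cat addrACA.
Qed.

Lemma has_betas_word a : word_monoid p a -> has_betas 0 a.
Proof. by exists [::], a; split; rewrite // big_nil add0r. Qed.

Lemma has_betas_genB_nth l : has_betas 1 (genB_nth l).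
Proof.
by exists [:: l], 0; split; rewrite ?big_seq1 ?addr0//; exact: word_monoid0.
Qed.

Lemma has_betas_mul_genB_nth n l : has_betas n (genB_nth l *+ n).
Proof.
elim: n => [|n IH]; first by rewrite mulr0n; exact/has_betas_word/word_monoid0.
by rewrite mulrS; apply: (has_betasD (has_betas_genB_nth l)).
Qed.

Lemma exponents_generated
    (G_ge0 : genA p `|` genB p beta `<=` [set x | 0 <= x]) :
  generated_submonoid G_ge0 = exponents :> set R.
Proof.
rewrite -[LHS]/(smallest (@add_submonoid R) (genA p `|` genB p beta)).
apply/seteqP; split=> x.
  move=> Mx; apply: Mx; split.
    split; first by exists 0%N; exact/has_betas_word/word_monoid0.
    by move=> u v [m um] [n vn]; exists (m + n)%N; exact: has_betasD.
  move=> y [/word_monoid_genA yw|/genB_sub_range[l _ <-]].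
    by exists 0%N; exact: has_betas_word.
  by exists 1%N; exact: has_betas_genB_nth.
move=> [_ [ls [_ [_ [ss ssP ->] ->]]]] N [[N0 ND] GN]; apply: (ND).
  by apply: (big_ind N) => // l _; apply: GN; right; exact: genB_nth_mem.
elim: ss ssP => [|s ss IH] /=; first by rewrite wsum_nil.
move=> /andP[sP ssP]; rewrite wsum_cat; apply: (ND); last exact: IH.
by apply: GN; left; exact: genA_word.
Qed.

Context (p_incr : {homo p : m n / (m < n)%N}) (p_prime : forall n, prime (p n))
  (iota_lt1 : forall l, wsum (iota 0 l) < 1) (beta_irr : irrational beta).

Lemma wsum_rational s : exists q : rat, wsum s = ratr q.
Proof.
exists (\sum_(i <- s) (p i)%:R^-1); rewrite rmorph_sum; apply: eq_bigr => i _.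
by rewrite fmorphV rmorph_nat.
Qed.

Lemma sum_genB_nth ls : \sum_(l <- ls) genB_nth l =
  beta *+ size ls - wsum (flatten [seq iota 0 l | l <- ls]).
Proof.
elim: ls => [|l ls IH] /=; first by rewrite big_nil wsum_nil subr0.
by rewrite big_cons IH wsum_cat mulrS /genB_nth; ring.
Qed.

Lemma has_betas_rational n x :
  has_betas n x -> exists q : rat, x = beta *+ n + ratr q.
Proof.
move=> [ls [_ [<- [ss _ ->] ->]]]; rewrite sum_genB_nth.
have [q ->] := wsum_rational (flatten ss).
have [q' ->] := wsum_rational (flatten [seq iota 0 l | l <- ls]).
by exists (q - q'); rewrite rmorphB; ring.
Qed.

Lemma has_betas_uniq m n x : has_betas m x -> has_betas n x -> m = n.
Proof.
move=> /has_betas_rational[q ->] /has_betas_rational[q' e].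
apply/eqP/negP => mn; apply: beta_irr; exists ((q' - q) / (m%:R - n%:R)) => //.
have mn0 : m%:R - n%:R != 0 :> R by rewrite subr_eq0 eqr_nat; exact/negP.
rewrite fmorph_div !rmorphB !rmorph_nat.
apply: (mulIf mn0); rewrite mulfVK// mulrBr !mulr_natr.
lra.
Qed.

Definition betas (x : R) : nat := xget 0%N [set n | has_betas n x].

Lemma betasE n x : has_betas n x -> betas x = n.
Proof.
move=> nx; apply: has_betas_uniq (nx).
by apply: (@xgetPex _ 0%N [set k | has_betas k x]); exists n.
Qed.

Lemma betasP x : exponents x -> has_betas (betas x) x.
Proof. by move=> [n nx]; rewrite (betasE nx). Qed.

Lemma betasD x y : exponents x -> exponents y ->
  betas (x + y) = (betas x + betas y)%N.
Proof. by move=> /betasP xP /betasP yP; exact/betasE/has_betasD. Qed.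

Lemma has_betas0 x : has_betas 0 x -> word_monoid p x.
Proof. by move=> [ls [a [/size0nil -> aP ->]]]; rewrite big_nil add0r. Qed.

(** Allowing a subtracted initial segment also when [n = 0], where an empty one
    does, lets the chain argument treat both cases at once. *)
Lemma has_betas_le1 n x : has_betas n x -> (n <= 1)%N ->
  exists l s, x = beta *+ n - wsum (iota 0 l) + wsum s.
Proof.
move=> [ls [_ [<- [ss _ ->] ->]]]; rewrite sum_genB_nth.
case: ls => [|l [|//]] _ /=.
  by exists 0%N, (flatten ss).
by exists l, (flatten ss); rewrite cats0.
Qed.

(** Once the number of betas is constant along the chain, the cofactors are sums
    of elements of [A], and the word of any nonzero one repeats a letter, which
    happens only finitely often along the chain. *)
Lemma exponent_chain_stable (x y : nat -> R) :
  (forall n, exponents (x n)) -> (forall n, exponents (y n)) ->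
  (forall n, x n = x n.+1 + y n) -> (betas (x 0%N) <= 1)%N ->
  exists N, forall n, (N <= n)%N -> y n = 0.
Proof.
move=> Mx My xE x0_le1.
have betasS n : betas (x n) = (betas (x n.+1) + betas (y n))%N.
  by rewrite xE betasD.
have [N0 stable] : exists N, forall n, (N <= n)%N -> betas (x n) = betas (x N).
  apply: (@nonincreasing_stable (fun n => betas (x n))) => n.
  by rewrite (betasS n) leq_addr.
have xN0_le1 : (betas (x N0) <= 1)%N.
  by elim: (N0) => // n; rewrite (betasS n); exact/leq_trans/leq_addr.
(* From [N0] on the number of betas is constant: [y] takes values in the monoid
   generated by [A]. *)
pose y' n := y (N0 + n)%N.
have /choice[ss ssP] : forall n, exists ss,
    all gen_word ss /\ y' n = wsum (flatten ss).
  move=> n; have : has_betas 0 (y' n).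
    have -> : 0%N = betas (y' n).
      apply/eqP; rewrite -(eqn_add2l (betas (x (N0 + n).+1))) addn0 -betasS.
      by rewrite !stable//; lia.
    exact/betasP/My.
  by move=> /has_betas0[ss]; exists ss.
pose e n := flatten (ss n).
have x_sum n : x N0 = x (N0 + n)%N + wsum (flatten (mkseq e n)).
  elim: n => [|n ->]; first by rewrite addn0 wsum_nil addr0.
  rewrite mkseqS -cats1 flatten_cat /= cats0 wsum_cat xE addnS.
  by have [_ e_n] := ssP n; rewrite -[y _]/(y' n) e_n -addrA [X in _ + X]addrC.
have [l0 [c xN0]] := has_betas_le1 (betasP (Mx N0)) xN0_le1.
have [|N eN] :=
  @partial_words_stable R p p_incr p_prime e c (iota 0 l0) iota_lt1.
  move=> n; have := betasP (Mx (N0 + n)%N); rewrite stable ?leq_addr//.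
  move=> /has_betas_le1-/(_ xN0_le1)[l [t xn]]; exists t, l.
  have := x_sum n; rewrite xN0 xn !wsum_cat; lra.
exists (N0 + N)%N => n N0Nn.
have -> : n = (N0 + (n - N0))%N by lia.
have [ss_gen ye] := ssP (n - N0)%N; rewrite -[y _]/(y' _) ye.
have := eN (n - N0)%N; rewrite leq_subRL; last lia.
move=> /(_ N0Nn); rewrite /e.
case: (ss _) ss_gen => [_ _|s ss' /= /andP[sP _] small].
  exact: wsum_nil.
have [j j2] := gen_word_double sP.
by have := small j; rewrite /= count_cat leqNgt (leq_trans j2)// leq_addr.
Qed.

(** Only one of the summands has a [beta].  If the other one were nonzero, an
    initial segment would have the value of a word with a repeated letter [j]; by
    the congruence modulo [p j] this letter occurs at least [p j] times, so the
    word is worth at least 1, which is too much for a segment. *)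
Lemma genB_nth_atom L x y : exponents x -> exponents y -> x + y = genB_nth L ->
  x = 0 \/ y = 0.
Proof.
wlog y0 : x y / betas y = 0%N => [wl Mx My xy|].
  have : (betas x + betas y = 1)%N.
    by rewrite -betasD// xy; exact/betasE/has_betas_genB_nth.
  case E : (betas y) => [|n] xy1; first exact: wl.
  have [|||] := wl y x _ My Mx; first by lia.
  - by rewrite addrC.
  - by right.
  - by left.
move=> Mx My xy; right.
have := betasD Mx My.
rewrite xy y0 addn0 (betasE (has_betas_genB_nth L)) => /esym x1.
have := betasP Mx; rewrite x1 => /has_betas_le1-/(_ isT)[l [s xE]].
have := betasP My; rewrite y0 => /has_betas0[ss ssP yE].
have e : wsum (iota 0 l) = wsum (iota 0 L ++ s ++ flatten ss).
  by move: xy; rewrite /genB_nth xE yE !wsum_cat mulr1n; lra.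
rewrite yE; case: ss => [|w ss] in ssP yE e *; first exact: wsum_nil.
have [j j2] : exists j, (2 <= count_mem j w)%N.
  by apply: gen_word_double; case/andP: ssP.
exfalso; have := iota_lt1 l; apply/negP; rewrite -leNgt e.
rewrite -[1]/((size [:: j])%:R); apply: size_le_wsum => // i.
rewrite inE => /eqP ->; rewrite leqNgt; apply/negP => small.
have := wsum_count_mod p_incr p_prime j e.
rewrite [RHS]modn_small// count_uniq_mem ?iota_uniq// modn_small; last first.
  by rewrite (leq_ltn_trans (leq_b1 _))// prime_gt1.
move=> ek.
suff : (2 <= (j \in iota 0 l))%N by case: (_ \in _).
by rewrite ek /= !count_cat (leq_trans j2)// addnA addnCA leq_addr.
Qed.

Lemma genB_nth_le l L : (l <= L)%N ->
  genB_nth l = genB_nth L + wsum (iota l (L - l)).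
Proof.
move=> lL; rewrite /genB_nth -{1}(subnKC lL) iotaD add0n wsum_cat; ring.
Qed.

(** Replacing each of [c] generators [b_l] by [b_L] releases [c] tails of
    reciprocals, and these regroup since there are at least two of them. *)
Lemma mul_genB_nth_divides c x : exponents x -> (1 < c <= betas x)%N ->
  exists L0, forall L, (L0 <= L)%N -> exponents (x - genB_nth L *+ c).
Proof.
move=> /betasP[ls [a [sz aP xE]]] /andP[c1]; rewrite -sz {}xE => cls.
have szc : size (take c ls) = c by rewrite size_takel.
have [|L0 L0P] := @word_monoid_all_tails R p (take c ls); first by rewrite szc.
exists L0 => L /L0P[tailsP le_L].
have -> : \sum_(l <- ls) genB_nth l = genB_nth L *+ c +
    (\sum_(l <- take c ls) wsum (iota l (L - l)) +
     \sum_(l <- drop c ls) genB_nth l).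
  rewrite -{1}(cat_take_drop c ls) big_cat /= addrA; congr (_ + _).
  rewrite big_seq (eq_bigr (fun l => genB_nth L + wsum (iota l (L - l)))).
    by rewrite -big_seq big_split /= big_const_seq count_predT iter_addr_0 szc.
  by move=> l lls; apply: genB_nth_le; exact: (allP le_L).
exists (size (drop c ls)), (drop c ls).
exists (\sum_(l <- take c ls) wsum (iota l (L - l)) + a); split => //.
  exact: word_monoidD.
by ring.
Qed.

End Exponents.

(** * Factorization in domains *)

Section Domain.
Context {D : idomainType}.
Implicit Types x y u : D.

Lemma principal_ideal_mem x y :
  divides x y <-> principal_ideal y `<=` principal_ideal x.
Proof.
split=> [[q ->] _ [r _ <-]|yx]; first by exists (q * r); rewrite ?mulrA.
by have [|r _ <-] := yx y; [exists 1; rewrite ?mulr1|exists r].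
Qed.

Lemma eventually_unit_elt_ACCP x :
  (forall a r : nat -> D, divides (a 0%N) x ->
    (forall n, a n = a n.+1 * r n) ->
    exists N, forall n, (N <= n)%N -> r n \is a GRing.unit) -> elt_ACCP x.
Proof.
move=> units a a_chain a0x.
have /choice[r rE] : forall n, exists r, a n = a n.+1 * r.
  by move=> n; apply/principal_ideal_mem.
have [|N unitN] := units a r _ rE.
  by apply/principal_ideal_mem; rewrite a0x.
exists N => n /subnKC <-; elim: (n - N)%N => [|k IH]; first by rewrite addn0.
rewrite addnS -IH; apply/seteqP; split; last exact: a_chain.
apply/principal_ideal_mem; exists (r (N + k)%N)^-1.
by rewrite [X in X * _]rE mulrK ?unitN// leq_addr.
Qed.

(** The unit lets units factor too, which makes the property multiplicative. *)
Definition factors x : Prop := exists u (s : seq D),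
  [/\ u \is a GRing.unit, forall y, y \in s -> irreducible_elt y
    & x = u * \prod_(y <- s) y].

Lemma factors_unit u : u \is a GRing.unit -> factors u.
Proof. by move=> uU; exists u, [::]; split; rewrite // big_nil mulr1. Qed.

Lemma factors_irreducible x : irreducible_elt x -> factors x.
Proof.
move=> xI; exists 1, [:: x]; split; rewrite ?unitr1 ?big_seq1 ?mul1r//.
by move=> y; rewrite inE => /eqP ->.
Qed.

Lemma factorsM x y : factors x -> factors y -> factors (x * y).
Proof.
move=> [u [s [uU sI ->]]] [v [t [vU tI ->]]]; exists (u * v), (s ++ t).
rewrite big_cat unitrMl// mulrACA; split=> // z.
by rewrite mem_cat => /orP[/sI|/tI].
Qed.

Lemma factorsX x n : factors x -> factors (x ^+ n).
Proof.
move=> xF; elim: n => [|n IH]; first exact/factors_unit/unitr1.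
by rewrite exprS; exact: factorsM.
Qed.

Lemma irreducible_unitM u x :
  u \is a GRing.unit -> irreducible_elt x -> irreducible_elt (u * x).
Proof.
move=> uU [x0 xU x_irr]; split.
- by rewrite mulf_neq0//; apply: contraTneq uU => ->; rewrite unitr0.
- by rewrite unitrMr.
- move=> y z /(canRL (mulKr uU)); rewrite mulrA => /x_irr[|]; last by right.
  by rewrite unitrMr ?unitrV//; left.
Qed.

Lemma factors_nonunit x : factors x -> x \isn't a GRing.unit ->
  exists2 s : seq D, (forall y, y \in s -> irreducible_elt y)
                   & x = \prod_(y <- s) y.
Proof.
move=> [u [[|y s] [uU sI ->]]]; first by rewrite big_nil mulr1 uU.
move=> _; exists (u * y :: s); last by rewrite !big_cons mulrA.
move=> z; rewrite inE => /orP[/eqP ->|zs]; last by apply: sI; rewrite inE zs orbT.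
by apply: irreducible_unitM => //; apply: sI; rewrite mem_head.
Qed.

(** Otherwise [x] splits off a nonunit again and again, and the cofactors that
    are left generate ever larger principal ideals. *)
Lemma elt_ACCP_has_factors x : x != 0 -> elt_ACCP x -> factors x.
Proof.
move=> x0 x_accp; apply: contrapT => xN.
pose bad y := y != 0 /\ ~ factors y.
pose next y z := bad z /\ exists2 w, y = z * w & w \isn't a GRing.unit.
have ex_next y : bad y -> exists z, next y z.
  move=> [y0 yN]; apply: contrapT => no_next.
  apply: (yN); apply: factors_irreducible; split=> // [|z w yzw].
    by apply/negP => yU; apply: yN; exact: factors_unit.
  apply: contrapT => /not_orP[/negP zU /negP wU].
  move: (y0); rewrite yzw mulf_eq0 negb_or => /andP[z0 w0].
  have [zF|zN] := pselect (factors z); last first.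
    by apply: no_next; exists z; split=> //; exists w.
  have [wF|wN] := pselect (factors w); last first.
    by apply: no_next; exists w; split=> //; exists z; rewrite // mulrC.
  by apply: yN; rewrite yzw; exact: factorsM.
have [a aP] : exists a : nat -> D, a 0%N = x /\ forall n, next (a n) (a n.+1).
  pose step y := xget y (next y).
  have stepP y : bad y -> next y (step y) by move=> /ex_next; exact: xgetPex.
  exists (fun n => iter n step x); split=> // n.
  suff : bad (iter n step x) by move=> /stepP.
  by elim: n => [//|n /stepP[]].
have [a0 aS] := aP.
have [n|| N stab] := x_accp a; last first.
- have [_ [w aw /negP[]]] := aS N.
  have : principal_ideal (a N.+1) `<=` principal_ideal (a N).
    by rewrite stab.
  move=> /principal_ideal_mem[q]; rewrite aw -mulrA -[X in X = _]mulr1.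
  move=> /mulfI; have [[aN0 _] _] := aS N; move=> /(_ aN0) e.
  by apply/unitrPr; exists q.
- by rewrite a0.
- by apply/principal_ideal_mem; have [_ [w -> _]] := aS n; exists w.
Qed.

End Domain.

(** * Leading exponents in a monoid algebra *)

(** Two such orders on the same exponents are used together, so the order is an
    argument rather than a structure on the exponents. *)
Definition translation_order (E : conomType) (le : rel E) : Prop :=
  [/\ total le, antisymmetric le, transitive le &
      forall x y z, le x y -> le (mmul x z) (mmul y z)].

Section MonoidAlgebra.
Context (F : fieldType) {R : realType} (M : nneg_submonoid R).
Local Notation E := (exponent M).
Local Notation A := (monoid_algebra F M).
Implicit Types (g h : A) (m n : E).

Lemma exponent_mulI m : injective (mmul m).
Proof.
move=> x y /(congr1 (@exponent_val R M)); rewrite !exponent_valM => /addrI.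
exact: exponent_val_inj.
Qed.

Definition is_lead (le : rel E) g m : Prop :=
  m \in msupp g /\ forall m', m' \in msupp g -> le m' m.

Definition lead (le : rel E) g : E := xget (@mone E) [set m | is_lead le g m].

Section Lead.
Context (le : rel E) (le_order : translation_order le).

Lemma leadP g : g != 0 -> is_lead le g (lead le g).
Proof.
have [tot _ trans _] := le_order.
rewrite -(@msupp_eq0 E F g) => /fset0Pn[m0 m0g].
apply: (@xgetPex _ (@mone E) [set m | is_lead le g m]).
suff [m mg mP] : exists2 m, m \in (msupp g : seq E) &
    forall m', m' \in (msupp g : seq E) -> le m' m.
  by exists m.
have : (msupp g : seq E) != [::].
  by case: (enum_fset _) (m0g : m0 \in (msupp g : seq E)).
elim: (msupp g : seq E) => // x s IH _; have [->|/IH[m ms mP]] := eqVneq s [::].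
  exists x; rewrite ?mem_head// => y; rewrite inE => /eqP ->.
  by have := tot x x; rewrite orbb.
have [xm|mx] := orP (tot x m).
  exists m; first by rewrite inE ms orbT.
  by move=> y; rewrite inE => /orP[/eqP ->|/mP].
exists x; first by rewrite mem_head.
move=> y; rewrite inE => /orP[/eqP ->|/mP ym]; last exact: trans ym mx.
by have := tot x x; rewrite orbb.
Qed.

Lemma is_lead_uniq g m n : is_lead le g m -> is_lead le g n -> m = n.
Proof.
have [_ anti _ _] := le_order.
by move=> [mg mP] [ng nP]; apply: anti; rewrite nP// mP.
Qed.

Lemma leadE g m : is_lead le g m -> lead le g = m.
Proof.
move=> gm; apply: is_lead_uniq (gm).
by apply: (@xgetPex _ (@mone E) [set k | is_lead le g k]); exists m.
Qed.

(** No other two exponents of the factors have the same sum as the leading ones,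
    so its coefficient in the product is a product of two nonzero scalars. *)
Lemma leadM g h : g != 0 -> h != 0 ->
  lead le (g * h) = mmul (lead le g) (lead le h).
Proof.
have [_ anti trans le_mul] := le_order.
move=> /leadP[] + + /leadP[].
move: (lead le g) (lead le h) => m1 m2 m1g m1M m2h m2M; apply: leadE.
have le_top k1 k2 : k1 \in msupp g -> k2 \in msupp h ->
    le (mmul k1 k2) (mmul m1 k2) /\ le (mmul m1 k2) (mmul m1 m2).
  move=> /m1M k1m /m2M k2m; split; first exact: le_mul.
  by rewrite ![mmul m1 _]mulmC; exact: le_mul.
have top_uniq k1 k2 : k1 \in msupp g -> k2 \in msupp h ->
    mmul k1 k2 = mmul m1 m2 -> k1 = m1 /\ k2 = m2.
  move=> k1g k2h e; have [le1 le2] := le_top k1 k2 k1g k2h.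
  have e2 : mmul m1 k2 = mmul m1 m2 by apply: anti; rewrite le2 -e le1.
  have k2m : k2 = m2 by exact: exponent_mulI e2.
  by split=> //; move: e; rewrite k2m ![mmul _ m2]mulmC; exact: exponent_mulI.
split; last first.
  move=> k /(@msuppM_le E F)[k1 [k2 [k1g k2h ->]]].
  by have [le1 le2] := le_top k1 k2 k1g k2h; exact: trans le1 le2.
rewrite -mcoeff_neq0 (mcoeffMl (g : {malg F[E]})).
rewrite (big_fsetD1 m1)//= (big_fsetD1 m2)//= eqxx.
rewrite [X in _ + X + _]big1_seq => [|k2 /andP[_]]; last first.
  rewrite !inE => /andP[k2m k2h]; case: eqP => // e.
  by have [_ ek] := top_uniq _ _ m1g k2h e; rewrite ek eqxx in k2m.
rewrite [X in _ + X]big1_seq => [|k1 /andP[_]]; last first.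
  rewrite !inE => /andP[k1m k1g]; apply: big1_seq => k2 /andP[_ k2h].
  case: eqP => // e.
  by have [ek _] := top_uniq _ _ k1g k2h e; rewrite ek eqxx in k1m.
by rewrite !addr0 mulr1n mulf_neq0// mcoeff_neq0.
Qed.

End Lead.

Definition deg_le : rel E := fun m n => exponent_val m <= exponent_val n.

Lemma deg_le_order : translation_order deg_le.
Proof.
split=> [x y|x y|y x z|x y z]; rewrite /deg_le.
- exact: le_total.
- by move=> /le_anti/exponent_val_inj.
- exact: le_trans.
- by rewrite !exponent_valM lerD2r.
Qed.

Lemma monoid_algebra_unit g :
  g != 0 -> (forall m, m \in msupp g -> m = @mone E) -> g \is a GRing.unit.
Proof.
move=> g0 g_const; pose c := (g : {malg F[E]})@_(@mone E).
have gE : g = malgC c :> {malg F[E]}.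
  apply/malgP => k; rewrite mcoeffC; case: eqP => [->//|/eqP k1].
  by rewrite mulr0n mcoeff_outdom//; apply: contra k1 => /g_const ->.
have c0 : c != 0.
  by apply: contraNneq g0 => c0; apply/eqP; rewrite gE c0; exact: malgC0E.
apply/unitrPr; exists (malgC c^-1 : {malg F[E]}).
rewrite gE -[LHS]/((malgC c : {malg F[E]}) * malgC c^-1) -rmorphM mulfV//.
Qed.

Definition monom m : A := << 1 *g m >> : {malg F[E]}.

Lemma monom_neq0 m : monom m != 0.
Proof. by rewrite (@monalgU_eq0 E F) oner_eq0. Qed.

Lemma monomM m n : monom m * monom n = monom (mmul m n).
Proof.
rewrite /monom -[LHS]/((<< m >> : {malg F[E]}) * << n >>).
by rewrite malgM_def fgmulUU mulr1.
Qed.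

Lemma lead_monom le m : translation_order le -> lead le (monom m) = m.
Proof.
move=> ord; apply: leadE => //; rewrite /is_lead /monom msuppU1.
rewrite inE eqxx; split=> // m'; rewrite inE => /eqP ->.
by have [tot _ _ _] := ord; have := tot m m; rewrite orbb.
Qed.

Lemma monom_divides m g :
  (forall k, k \in msupp g -> exists n, k = mmul m n) -> divides (monom m) g.
Proof.
move=> div; have /choice[q qP] : forall k, exists n, k \in msupp g -> k = mmul m n.
  move=> k; have [/div[n ->]|_] := boolP (k \in msupp g); first by exists n.
  by exists (@mone E).
exists (\sum_(k <- msupp g) << (g : {malg F[E]})@_k *g q k >> : {malg F[E]}).
rewrite /monom -[RHS]/((<< m >> : {malg F[E]}) * _) mulr_sumr.
rewrite [LHS](@monalgE E F) big_seq [RHS]big_seq; apply: eq_bigr => k kg.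
by rewrite malgM_def fgmulUU mul1r -qP.
Qed.

End MonoidAlgebra.

(** * Chain conditions in the monoid algebra *)

Lemma eventually_all (T : eqType) (s : seq T) (P : T -> nat -> Prop) :
  (forall x, x \in s -> exists N, forall n, (N <= n)%N -> P x n) ->
  exists N, forall x, x \in s -> forall n, (N <= n)%N -> P x n.
Proof.
elim: s => [|x s IH] evP; first by exists 0%N.
have [N1 P1] := evP x (mem_head _ _).
have [|N2 P2] := IH; first by move=> y ys; apply: evP; rewrite inE ys orbT.
exists (maxn N1 N2) => y; rewrite inE => /orP[/eqP ->|ys] n.
  by rewrite geq_max => /andP[/P1].
by rewrite geq_max => /andP[_ /P2]; exact.
Qed.

Section ChainConditions.
Context (F : fieldType) {R : realType} (p : nat -> nat) (beta : R).
Context (p_incr : {homo p : m n / (m < n)%N}) (p_prime : forall n, prime (p n))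
  (iota_lt1 : forall l, wsum p (iota 0 l) < 1 :> R)
  (beta_irr : irrational beta).
Context (M : nneg_submonoid R) (ME : M = exponents p beta :> set R).
Local Notation E := (exponent M).
Local Notation A := (monoid_algebra F M).
Local Notation val := (@exponent_val R M).
Implicit Types (f g h : A) (m : E).

Definition nbeta m : nat := betas p beta (val m).

Lemma exponentsP m : exponents p beta (val m).
Proof. by rewrite -ME; exact: exponentP. Qed.

Lemma exponent_of x : exponents p beta x -> exists m, val m = x.
Proof. by rewrite -ME => Mx; exists (Exponent Mx). Qed.

Lemma exponent_genB_nth l : exists b, val b = genB_nth p beta l.
Proof. by apply: exponent_of; exists 1%N; exact: has_betas_genB_nth. Qed.

Lemma exponent_ge0 m : 0 <= val m.
Proof. exact: nneg_set_ge0 (exponentP m). Qed.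

Lemma nbetaM m (n : E) : nbeta (mmul m n) = (nbeta m + nbeta n)%N.
Proof. by rewrite /nbeta exponent_valM betasD//; exact: exponentsP. Qed.

Lemma nbeta1 : nbeta (@mone E) = 0%N.
Proof.
apply/eqP; rewrite -(eqn_add2l (nbeta (@mone E))) addn0 -nbetaM.
by rewrite mul1m.
Qed.

(** With fewer betas counted as larger, the leading exponent is the largest one
    among those with the least number of betas. *)
Definition nbeta_le : rel E := fun m n =>
  (nbeta n < nbeta m)%N || (nbeta m == nbeta n) && (val m <= val n).

Lemma nbeta_le_order : translation_order nbeta_le.
Proof.
split=> [x y|x y|y x z|x y z]; rewrite /nbeta_le.
- by case: (ltngtP (nbeta x) (nbeta y)) => //= _; exact: le_total.
- by case: (ltngtP (nbeta x) (nbeta y)) => //= _ /le_anti/exponent_val_inj.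
- move=> /orP[xy|/andP[/eqP xy lxy]] /orP[yz|/andP[/eqP yz lyz]].
  + by rewrite (ltn_trans yz xy).
  + by rewrite -yz xy.
  + by rewrite xy yz.
  + by rewrite xy yz eqxx (le_trans lxy lyz) orbT.
- by rewrite !nbetaM ltn_add2r eqn_add2r !exponent_valM lerD2r.
Qed.

Local Notation low := (lead nbeta_le).
Local Notation deg := (lead (@deg_le R M)).

Lemma low_le f m : m \in msupp f -> (nbeta (low f) <= nbeta m)%N.
Proof.
move=> mf; have f0 : f != 0.
  by apply: contraTneq mf => ->; rewrite (@msupp0 E F) inE.
have [_ /(_ m mf)] := leadP nbeta_le_order f0.
by rewrite /nbeta_le; case: ltngtP.
Qed.

Lemma deg_le0_unit f : f != 0 -> val (deg f) <= 0 -> f \is a GRing.unit.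
Proof.
move=> f0 deg_le0; have [_ deg_max] := leadP (deg_le_order M) f0.
apply: monoid_algebra_unit f0 _ => m /deg_max m_le.
apply: exponent_val_inj; apply/le_anti.
by rewrite exponent_ge0 (le_trans m_le deg_le0).
Qed.

(** The two leading exponents complement each other: the one for [nbeta_le]
    stabilizes by the chain condition on exponents, but may be 0 for a nonunit
    such as [1 + X^beta]; the degree of such a cofactor has a [beta], and so it
    uses up one of the finitely many betas of the degree. *)
Lemma elt_ACCP_low_le1 f : f != 0 -> (nbeta (low f) <= 1)%N -> elt_ACCP f.
Proof.
move=> f0 f_le1; apply: eventually_unit_elt_ACCP => a r [q fE] aE.
have [a00 q0] : a 0%N != 0 /\ q != 0.
  by apply/andP; rewrite -negb_or -mulf_eq0 -fE.
have aS n : a n.+1 != 0 /\ r n != 0.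
  suff : a n != 0 by rewrite aE mulf_eq0 negb_or => /andP[].
  by elim: n => // n; rewrite aE mulf_eq0 negb_or => /andP[].
have a_neq0 n : a n != 0 by case: n => // n; have [] := aS n.
have r_neq0 n : r n != 0 by have [] := aS n.
have lowE n : low (a n) = mmul (low (a n.+1)) (low (r n)).
  by rewrite {1}aE; exact: leadM nbeta_le_order _ _ _ _.
have degE n : deg (a n) = mmul (deg (a n.+1)) (deg (r n)).
  by rewrite {1}aE; exact: leadM (deg_le_order M) _ _ _ _.
have [|N1 low1] := exponent_chain_stable p_incr p_prime iota_lt1 beta_irr
  (fun n => exponentsP (low (a n))) (fun n => exponentsP (low (r n)))
  (fun n => congr1 val (lowE n)).
  apply: leq_trans f_le1; rewrite fE (leadM nbeta_le_order)// nbetaM.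
  exact: leq_addr.
have [N2 deg2] : exists N, forall n, (N <= n)%N ->
    nbeta (deg (a n)) = nbeta (deg (a N)).
  apply: (@nonincreasing_stable (fun n => nbeta (deg (a n)))) => n.
  by rewrite (degE n) nbetaM leq_addr.
exists (maxn N1 N2) => n; rewrite geq_max => /andP[/low1 low_r N2n].
have low_r1 : low (r n) = @mone E by exact: exponent_val_inj.
have deg_r0 : nbeta (deg (r n)) = 0%N.
  have := congr1 nbeta (degE n); rewrite nbetaM deg2// deg2; last exact: leqW.
  by move/eqP; rewrite -{1}[nbeta _]addn0 eqn_add2l eq_sym => /eqP.
have [degr_supp _] := leadP (deg_le_order M) (r_neq0 n).
have degr_le0 : val (deg (r n)) <= 0.
  have [_ /(_ _ degr_supp)] := leadP nbeta_le_order (r_neq0 n).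
  by rewrite /nbeta_le low_r1 nbeta1 deg_r0.
exact: deg_le0_unit.
Qed.

Lemma nbetaE n m : has_betas p beta n (val m) -> nbeta m = n.
Proof. exact: betasE. Qed.

Lemma monomX m c : exists mc, val mc = val m *+ c /\ monom F m ^+ c = monom F mc.
Proof.
elim: c => [|c [mc [mcE mE]]]; first by exists (@mone E); rewrite expr0.
by exists (mmul m mc); rewrite exponent_valM mcE mulrS exprS mE monomM.
Qed.

(** If all exponents in [S] have two betas or more, [c] is the least of these
    numbers, and the quotient of an element that attains it has an exponent
    without [beta]; otherwise [c = 0] works.  The divisor is a power of an
    irreducible monomial, so that the same witness serves for atomicity. *)
Lemma weak_ACCP_witness (S : set A) : finite_set S -> S !=set0 ->
  S `<=` [set f | f != 0] -> exists (b : E) (l c : nat),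
  [/\ val b = genB_nth p beta l, forall f, S f -> divides (monom F b ^+ c) f &
      exists2 f, S f & exists2 t, f = monom F b ^+ c * t & elt_ACCP t].
Proof.
move=> /finite_seqP[s Ss] [f0 Sf0] S_neq0.
have ex_low : exists k, `[< exists2 f, S f & nbeta (low f) = k >].
  by exists (nbeta (low f0)); apply/asboolP; exists f0.
case: (ex_minnP ex_low) => c /asboolP[f Sf fc] c_min.
have [c_le1|c_gt1] := leqP c 1.
  have [b bE] := exponent_genB_nth 0.
  exists b, 0%N, 0%N; split=> //.
    by move=> g _; exists g; rewrite expr0 mul1r.
  exists f => //; exists f; first by rewrite expr0 mul1r.
  by apply: elt_ACCP_low_le1; [exact: S_neq0|rewrite fc].
have [L LP] : exists L, forall g, g \in s -> forall l, (L <= l)%N ->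
    forall m, m \in msupp g -> exponents p beta (val m - genB_nth p beta l *+ c).
  apply: eventually_all => g gs.
  have Sg : S g by rewrite Ss.
  have [|L LP] := @eventually_all E (enum_fset (msupp g))
      (fun m l => exponents p beta (val m - genB_nth p beta l *+ c)).
    move=> m mg; apply: (mul_genB_nth_divides beta_irr); first exact: exponentsP.
    rewrite c_gt1 (leq_trans _ (low_le mg))//.
    by apply: c_min; apply/asboolP; exists g.
  by exists L => l Ll m mg; exact: LP.
have [b bE] := exponent_genB_nth L.
have [bc [bcE bX]] := monomX b c.
have bc_div g : S g -> divides (monom F bc) g.
  move=> Sg; apply: monom_divides => m mg.
  have gs : g \in s by move: Sg; rewrite Ss.
  have [n nE] := exponent_of (LP g gs L (leqnn L) m mg).
  exists n; apply: exponent_val_inj.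
  by rewrite exponent_valM nE bcE bE addrC subrK.
exists b, L, c; rewrite bX; split=> //; exists f => //.
have [t ft] := bc_div f Sf; exists t => //.
have f_neq0 : f != 0 by exact: S_neq0.
have t_neq0 : t != 0 by apply: contraNneq f_neq0; rewrite ft => ->; rewrite mulr0.
apply: elt_ACCP_low_le1 => //.
have bcn : nbeta bc = c.
  by apply: nbetaE; rewrite bcE bE; exact: has_betas_mul_genB_nth.
move: fc; rewrite ft (leadM nbeta_le_order) ?monom_neq0//.
rewrite (lead_monom _ _ nbeta_le_order) nbetaM bcn -[RHS]addn0.
by move=> /addnI ->.
Qed.

(** Degrees add up, so one of two factors has degree 0 by atomicity of [b_l]. *)
Lemma monom_irreducible b l :
  val b = genB_nth p beta l -> irreducible_elt (monom F b).
Proof.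
move=> bE; have degM := @leadM F R M _ (deg_le_order M).
have b1 : nbeta b = 1%N by apply: nbetaE; rewrite bE; exact: has_betas_genB_nth.
split; first exact: monom_neq0.
  apply/negP => /unitrPr[h bh].
  have h0 : h != 0.
    by apply: contra_eqN bh => /eqP ->; rewrite mulr0 eq_sym oner_eq0.
  have := congr1 (fun g => nbeta (deg g)) bh.
  rewrite degM ?monom_neq0// (lead_monom _ _ (deg_le_order M)) nbetaM b1.
  rewrite -[1 : A]/(monom F (@mone E)) (lead_monom _ _ (deg_le_order M)).
  by rewrite nbeta1.
move=> g h bgh.
have : monom F b != 0 by exact: monom_neq0.
rewrite bgh mulf_eq0 negb_or => /andP[g0 h0].
have deg_gh : val (deg g) + val (deg h) = genB_nth p beta l.
  by rewrite -exponent_valM -degM// -bgh (lead_monom _ _ (deg_le_order M)).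
have [dg|dh] := genB_nth_atom p_incr p_prime iota_lt1 beta_irr
  (exponentsP (deg g)) (exponentsP (deg h)) deg_gh.
  by left; apply: deg_le0_unit => //; rewrite dg.
by right; apply: deg_le0_unit => //; rewrite dh.
Qed.

Lemma atomic_monoid_algebra : atomic A.
Proof.
move=> f f0 f_nonunit.
have [||g ->//|b [l [c [bE _ [_ -> [t ft t_accp]]]]]] :=
  @weak_ACCP_witness [set f].
- exact: finite_set1.
- by exists f.
apply: factors_nonunit => //; rewrite ft; apply: factorsM.
  exact/factorsX/factors_irreducible/(monom_irreducible bE).
apply: elt_ACCP_has_factors => //.
by apply: contraNneq f0 => t0; rewrite ft t0 mulr0.
Qed.

Lemma weak_ACCP_monoid_algebra : weak_ACCP A.
Proof.
split; first exact: atomic_monoid_algebra.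
move=> S S_fin S_nonempty S_neq0.
have [b [l [c [_ b_div b_accp]]]] := weak_ACCP_witness S_fin S_nonempty S_neq0.
by exists (monom F b ^+ c).
Qed.

(** Consecutive exponents [2 b_l] and [2 b_(l+1)] differ by [2/p_l], a generator
    in [A]; the exponents [b_l] would not do, as [1/p_l] is not in the monoid. *)
Lemma not_ACCP_monoid_algebra : ~ ACCP A.
Proof.
have /choice[x xE] : forall l, exists m, val m = genB_nth p beta l *+ 2.
  by move=> l; apply: exponent_of; exists 2; exact: has_betas_mul_genB_nth.
have xS l : val (x l) = val (x l.+1) + wsum p [:: l; l].
  rewrite !xE (genB_nth_le p beta (leqnSn l)) subSnn.
  by rewrite !wsum_cons !wsum_nil mulrnDl addr0.
move=> /(_ (fun l => monom F (x l)))[|N stab].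
  move=> l; apply/principal_ideal_mem.
  have [m mE] : exists m, val m = wsum p [:: l; l].
    apply: exponent_of; exists 0%N; apply/has_betas_word/word_monoid_word.
    by rewrite /= mem_head.
  exists (monom F m); rewrite monomM; congr monom.
  by apply: exponent_val_inj; rewrite exponent_valM mE.
have /principal_ideal_mem[q xq] :
  principal_ideal (monom F (x N.+1)) `<=` principal_ideal (monom F (x N)).
  by rewrite (stab _ (leqnSn N)).
have q0 : q != 0.
  by apply: contraNneq (monom_neq0 F (x N.+1)) => q0; rewrite xq q0 mulr0.
have := congr1 (fun g => val (deg g)) xq.
rewrite (leadM (deg_le_order M)) ?monom_neq0// exponent_valM.
rewrite !(lead_monom _ _ (deg_le_order M)) => e.
have := exponent_ge0 (deg q); have := xS N; rewrite !wsum_cons wsum_nil.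
have := invp_gt0 (R := R) p_prime N; lra.
Qed.

End ChainConditions.

Theorem theorem5p15 (F : fieldType) (R : realType) (p : nat -> nat) (beta : R)
  (p_incr : {homo p : m n / (m < n)%N})
  (p_odd_prime : forall n : nat, prime (p n) /\ odd (p n))
  (p_sum : ((\sum_(0 <= n <oo) ((p n)%:R^-1)%:E) < (3%:R^-1 : R)%:E)%E)
  (beta_gt1 : 1 < beta)
  (beta_irr : irrational beta) :
  let M : nneg_submonoid R := generated_submonoid (gen_ge0 p_sum beta_gt1) in
  weak_ACCP (monoid_algebra F M) /\ ~ ACCP (monoid_algebra F M).
Proof.
move=> M; have ME : M = exponents p beta :> set R by exact: exponents_generated.
have p_prime n : prime (p n) by case: (p_odd_prime n).
have iota_lt1 l : wsum p (iota 0 l) < 1 :> R.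
  have p_ge0 n : (0 <= ((p n)%:R^-1 : R)%:E)%E by rewrite lee_fin invr_ge0.
  rewrite -lte_fin /wsum -sumEFin -[l]subn0.
  apply: le_lt_trans (nneseries_lim_ge l (fun n _ _ => p_ge0 n)) _.
  by apply: lt_trans (p_sum) _; rewrite lte_fin invf_lt1// ltr1n.
split.
  exact: (weak_ACCP_monoid_algebra F p_incr p_prime iota_lt1 beta_irr ME).
exact: (not_ACCP_monoid_algebra p_prime ME).
Qed.
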